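(* Let $G$ be a distinguished group and $A$ a simple subgroup of $G$, and let $$G=A.l_0+A.l_1+\cdots+A.l_s,\qquad l_0\in A,$$ be a decomposition of $G$ into pairwise disjoint sets (so $A.l_0=A$). Let $\Gamma$ be the set of all those $A.l_j$ ($0\le j\le s$) for which $$(A.l_j).(A.l_h)=A.(l_j.l_h)\quad\text{for every } h=0,1,\dots,s .$$ Then $\Gamma$, with the composition $(X,Y)\mapsto X.Y$, is a distributive group; and the set $\Sigma$ of all elements of $G$ lying in some member of $\Gamma$ is a subgroup of $G$.
   Context: A distributive group is a nonempty set $G$ with a binary operation $(a,b)\mapsto a.b$ on $G$ such that for all $a,b\in G$ each of the equations $a.x=b$ and $y.a=b$ has exactly one solution in $G$, and for all $a,b,c\in G$, $(a.b).c=(a.c).(b.c)$ and $c.(a.b)=(c.a).(c.b)$. A subgroup of $G$ is a nonempty subset which is itself a distributive group under the restricted operation; the order is the number of elements. A distributive group is simple if it has no proper subgroup of order greater than one. For subsets $X,Y\subseteq G$ and $p\in G$: $X.Y=\{x.y: x\in X,\,y\in Y\}$, $X.p=\{x.p: x\in X\}$, $p.X=\{p.x:x\in X\}$. A finite distributive group $G$ is called distinguished if for every subgroup $B$ of $G$ and every $p\in G$, the sets $B.(B.p)$ and $(B.p).B$ are subgroups of the same order as $B$; equivalently there are $t,\tau\in G$ with $B.(B.p)=B.t$ and $(B.p).B=B.(p.B)=B.\tau$. In a distinguished group, any two sets $A.x$, $A.y$ are equal or disjoint, so a decomposition as in the claim exists. *)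

(* Defs.v *)
From mathcomp Require Import all_boot.

Set Implicit Arguments.
Unset Strict Implicit.
Unset Printing Implicit Defensive.

(* S, with op restricted to it, is a distributive group. *)
Definition distributive_group (T : Type) (op : T -> T -> T) (S : {pred T}) :
    Prop :=
  [/\ exists x, x \in S,
      {in S &, forall a b, op a b \in S},
      {in S &, forall a b, exists! x, x \in S /\ op a x = b},
      {in S &, forall a b, exists! y, y \in S /\ op y a = b} &
      {in S & &, forall a b c, op (op a b) c = op (op a c) (op b c)} /\
      {in S & &, forall a b c, op c (op a b) = op (op c a) (op c b)}].

(* X.Y and X.p *)
Definition set_op (T : finType) (op : T -> T -> T) (X Y : {set T}) : {set T} :=
  [set op x y | x in X, y in Y].

Definition rtrans (T : finType) (op : T -> T -> T) (X : {set T}) (p : T) :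
    {set T} :=
  [set op x p | x in X].

(* The ambient group is the whole type T. *)
Definition subgroup (T : finType) (op : T -> T -> T) (B : {set T}) : Prop :=
  distributive_group op B.

(* The one-element group is simple. *)
Definition simple_subgroup (T : finType) (op : T -> T -> T) (A : {set T}) :
    Prop :=
  subgroup op A /\
  forall B : {set T}, subgroup op B -> B \proper A -> ~~ (1 < #|B|).

Definition distinguished (T : finType) (op : T -> T -> T) : Prop :=
  distributive_group op [set: T] /\
  forall (B : {set T}) (p : T), subgroup op B ->
    [/\ subgroup op (set_op op B (rtrans op B p)),
        #|set_op op B (rtrans op B p)| = #|B|,
        subgroup op (set_op op (rtrans op B p) B) &
        #|set_op op (rtrans op B p) B| = #|B|].

(* G = A.l_0 + ... + A.l_s *)
Definition coset_decomposition (T : finType) (op : T -> T -> T) (A : {set T})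
    (s : nat) (l : 'I_s.+1 -> T) : Prop :=
  [/\ l ord0 \in A,
      \bigcup_(j < s.+1) rtrans op A (l j) = [set: T] &
      forall i j : 'I_s.+1, i != j ->
        [disjoint rtrans op A (l i) & rtrans op A (l j)]].

Definition Gamma (T : finType) (op : T -> T -> T) (A : {set T})
    (s : nat) (l : 'I_s.+1 -> T) : {set {set T}} :=
  [set rtrans op A (l j) | j : 'I_s.+1 &
    [forall h : 'I_s.+1,
      set_op op (rtrans op A (l j)) (rtrans op A (l h))
        == rtrans op A (op (l j) (l h))]].

Definition Sigma (T : finType) (op : T -> T -> T) (A : {set T})
    (s : nat) (l : 'I_s.+1 -> T) : {set T} :=
  [set x | [exists X in Gamma op A l, x \in X]].

(* Main.v *)
Require Import Defs.
From mathcomp Require Import all_boot.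

Set Implicit Arguments.
Unset Strict Implicit.
Unset Printing Implicit Defensive.

(** Left and right translations of a distributive group are automorphisms, so
    they map cosets of [A] injectively and preserve cardinalities.  The whole
    argument counts elements with them.

    Applied to [A], distinguishedness says that [A.(A.p)] has only [#|A|]
    elements; since it contains each translate [a.(A.p) = A.(a.p)], it equals
    all of them.  If [a.x = b.y], this gives [a.(A.x) = A.(a.x) = A.(b.y) =
    a.(A.y)], hence [A.x = A.y]: right cosets that meet coincide
    ([coset_eq]).

    For any [x] and [y], [(A.x).(A.y)] contains [A.(x.y)], because
    [(a.x).(a.y) = a.(x.y)].  So [X = A.l_j] lies in [Gamma] exactly when
    [X.Y] has the size of [A] for all cosets [Y], a condition that no longer
    mentions representatives ([mem_GammaP]).  When it holds, [X.Y] is a coset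
    and [x.Y = X.Y = X.y] for all [x] in [X] and [y] in [Y].

    The crux is that [Gamma] is closed ([steady_set_op]).  Let [X] and [Y] be
    in [Gamma] and let [Z] be a coset.  The map [U |-> X.U] sends cosets to
    cosets injectively, hence, by finiteness, surjectively: [Z = X.U].  For
    any [x] in [X],
      [(X.Y).Z = (x.Y).(x.U) = x.(Y.U)],
    which has the size of [Y.U], that is, of [A].

    Cancellation and distributivity in [Gamma] now follow from those of
    elements, through [X.Y = x.Y = X.y] and equality of sizes; and a finite,
    closed, cancellative set has unique solutions ([distributive_group_fin]).
    The latter also settles [Sigma]. *)

(** * Finite distributive groups *)

(** On a finite set an injective translation is onto, so solvability of
    [a.x = b] and [y.a = b] comes for free from cancellation. *)
Lemma distributive_group_fin (T : finType) (op : T -> T -> T) (S : {set T}) :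
    (exists x, x \in S) ->
    {in S &, forall a b, op a b \in S} ->
    {in S, forall a, {in S &, injective (op a)}} ->
    {in S, forall a, {in S &, injective (op^~ a)}} ->
    {in S & &, forall a b c, op (op a b) c = op (op a c) (op b c)} ->
    {in S & &, forall a b c, op c (op a b) = op (op c a) (op c b)} ->
  distributive_group op S.
Proof.
move=> S_n0 S_op injl injr distr distl.
have onto (f : T -> T) : {in S, forall x, f x \in S} -> {in S &, injective f} ->
    {in S, forall b, exists! x, x \in S /\ f x = b}.
  move=> fS finj b Sb.
  have /eqP fSE : f @: S == S.
    rewrite eqEcard card_in_imset // leqnn andbT.
    by apply/subsetP => _ /imsetP[x Sx ->]; apply: fS.
  have : b \in f @: S by rewrite fSE.
  case/imsetP=> x Sx bE; exists x; split=> // y [Sy fyE].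
  by apply: finj; rewrite // fyE.
split=> // a b Sa Sb.
- by apply: (onto (op a)) => // [x Sx|]; [apply: S_op | apply: injl].
- by apply: (onto (op^~ a)) => // [x Sx|]; [apply: S_op | apply: injr].
Qed.

(** * Products of subsets *)

Section SetProducts.

Variables (T : finType) (op : T -> T -> T).
Hypotheses (injl : forall a, injective (op a))
           (injr : forall a, injective (op^~ a)).
Implicit Types X Y : {set T}.

Lemma mem_set_op X Y x y : x \in X -> y \in Y -> op x y \in set_op op X Y.
Proof. by move=> Xx Yy; apply/imset2P; exists x y. Qed.

Lemma mem_rtrans X p x : x \in X -> op x p \in rtrans op X p.
Proof. by move=> Xx; apply: imset_f. Qed.

Lemma card_rtrans X p : #|rtrans op X p| = #|X|.
Proof. exact/card_imset/injr. Qed.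

(** A product with as few elements as one of its factors is a single
    translate of that factor. *)
Lemma ltrans_set_op X Y x :
  #|set_op op X Y| = #|Y| -> x \in X -> op x @: Y = set_op op X Y.
Proof.
move=> cXY Xx; apply/eqP; rewrite eqEcard cXY card_imset // leqnn andbT.
by apply/subsetP=> _ /imsetP[y Yy ->]; apply: mem_set_op.
Qed.

Lemma rtrans_set_op X Y y :
  #|set_op op X Y| = #|X| -> y \in Y -> rtrans op X y = set_op op X Y.
Proof.
move=> cXY Yy; apply/eqP; rewrite eqEcard cXY card_rtrans leqnn andbT.
by apply/subsetP=> _ /imsetP[x Xx ->]; apply: mem_set_op.
Qed.

End SetProducts.

(** * Right cosets of a subgroup *)

Section Cosets.

Variables (T : finType) (op : T -> T -> T) (A : {set T}).
Hypotheses (injl : forall a, injective (op a))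
           (injr : forall a, injective (op^~ a)).
Hypothesis distr : forall a b c, op (op a b) c = op (op a c) (op b c).
Hypothesis distl : forall a b c, op c (op a b) = op (op c a) (op c b).
Hypothesis A_n0 : exists a, a \in A.
Hypothesis A_op : {in A &, forall a b, op a b \in A}.
Hypothesis cardAA : forall p, #|set_op op A (rtrans op A p)| = #|A|.
Implicit Types X Y Z : {set T}.

Local Notation "X ** Y" := (set_op op X Y) (at level 40, left associativity).
Local Notation coset := (rtrans op A).

Lemma card_coset p : #|coset p| = #|A|.
Proof. exact: card_rtrans. Qed.

Lemma rtrans_mem a : a \in A -> coset a = A.
Proof.
move=> Aa; apply/eqP; rewrite eqEcard card_coset leqnn andbT.
by apply/subsetP=> _ /imsetP[b Ab ->]; apply: A_op.
Qed.

Lemma ltrans_coset a p : a \in A -> op a @: coset p = coset (op a p).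
Proof.
move=> Aa; apply/eqP; rewrite eqEcard card_imset // !card_coset leqnn andbT.
apply/subsetP=> _ /imsetP[_ /imsetP[b Ab ->] ->].
by rewrite distl mem_rtrans // A_op.
Qed.

Lemma set_op_coset a p : a \in A -> A ** coset p = coset (op a p).
Proof.
by move=> Aa; rewrite -ltrans_coset // (ltrans_set_op injl _ Aa) // cardAA card_coset.
Qed.

Lemma coset_eq x y z : z \in coset x -> z \in coset y -> coset x = coset y.
Proof.
case/imsetP=> a Aa zE /imsetP[b Ab zE'].
(* It suffices to compare the images under the injective translation by a. *)
apply: (imset_inj (@injl a)); rewrite ltrans_coset // -zE zE'.
by rewrite -set_op_coset // (ltrans_set_op injl _ Aa) // cardAA card_coset.
Qed.

Lemma coset_sub_set_op x y : coset (op x y) \subset coset x ** coset y.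
Proof.
by apply/subsetP=> _ /imsetP[a Aa ->]; rewrite distl mem_set_op // mem_rtrans.
Qed.

Lemma set_op_coset_card x y :
  (coset x ** coset y == coset (op x y)) = (#|coset x ** coset y| == #|A|).
Proof.
have leA : #|A| <= #|coset x ** coset y|.
  by rewrite -(card_coset (op x y)) subset_leq_card // coset_sub_set_op.
by rewrite eq_sym eqEcard coset_sub_set_op card_coset eqn_leq leA andbT.
Qed.

(** * Cosets with products of minimal size *)

(** The cosets whose product with any coset on the right does not grow: the
    description of [Gamma] without representatives. *)
Definition steady X : Prop :=
  (exists x, X = coset x) /\ forall y, #|X ** coset y| = #|A|.

Lemma steady_n0 X : steady X -> exists x, x \in X.
Proof.
by case=> [[x ->] _]; have [a Aa] := A_n0; exists (op a x); apply: mem_rtrans.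
Qed.

Lemma card_steady X : steady X -> #|X| = #|A|.
Proof. by case=> [[x ->] _]; apply: card_coset. Qed.

Lemma card_set_op_steady X Y : steady X -> steady Y -> #|X ** Y| = #|A|.
Proof. by case=> _ cX [[y ->] _]; apply: cX. Qed.

Lemma steady_set_op_coset X y :
  steady X -> exists z, X ** coset y = coset z.
Proof.
case=> [[x ->] cX]; exists (op x y).
by apply/eqP; rewrite set_op_coset_card cX.
Qed.

Lemma ltrans_steady X y x :
  steady X -> x \in X -> op x @: coset y = X ** coset y.
Proof.
by move=> [_ cX] Xx; apply: ltrans_set_op; rewrite // cX card_coset.
Qed.

(** Left multiplication by [X] acts on cosets as an injective translation by
    one of its elements, and there are finitely many cosets. *)
Lemma steady_onto X z : steady X -> exists y, coset z = X ** coset y.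
Proof.
move=> stX; have [x Xx] := steady_n0 stX.
pose K : {set {set T}} := [set coset y | y : T].
have injX : {in K &, injective (set_op op X)}.
  move=> _ _ /imsetP[u _ ->] /imsetP[v _ ->].
  by rewrite -!(ltrans_steady _ stX Xx); apply/imset_inj/injl.
have /eqP XK : set_op op X @: K == K.
  rewrite eqEcard (card_in_imset injX) leqnn andbT.
  apply/subsetP=> _ /imsetP[_ /imsetP[u _ ->] ->].
  by have [v ->] := steady_set_op_coset u stX; apply: imset_f.
have : coset z \in set_op op X @: K by rewrite XK imset_f.
by case/imsetP=> _ /imsetP[y _ ->] ->; exists y.
Qed.

Lemma ltrans_set_op_distr x Y Z :
  (op x @: Y) ** (op x @: Z) = op x @: (Y ** Z).
Proof.
apply/setP=> w; apply/imset2P/imsetP.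
- case=> _ _ /imsetP[y Yy ->] /imsetP[z Zz ->] ->.
  by exists (op y z); rewrite ?mem_set_op // distl.
- case=> _ /imset2P[y z Yy Zz ->] ->.
  by exists (op x y) (op x z); rewrite ?imset_f // distl.
Qed.

(** A coset [Z] can be written [X.U], which lets the common left factor [x]
    be pulled out of [(X.Y).(X.U)], leaving the product [Y.U] of known size. *)
Lemma steady_set_op X Y : steady X -> steady Y -> steady (X ** Y).
Proof.
move=> stX [[y ->] cY]; split; first exact: steady_set_op_coset.
move=> z; have [x Xx] := steady_n0 stX; have [u ->] := steady_onto z stX.
by rewrite -!(ltrans_steady _ stX Xx) ltrans_set_op_distr card_imset.
Qed.

Lemma steady_injl X Y Z :
  steady X -> steady Y -> steady Z -> X ** Y = X ** Z -> Y = Z.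
Proof.
move=> stX [[y ->] _] [[z ->] _]; have [x Xx] := steady_n0 stX.
by rewrite -!(ltrans_steady _ stX Xx); apply/imset_inj/injl.
Qed.

Lemma rtrans_steady X Y y :
  steady X -> steady Y -> y \in Y -> rtrans op X y = X ** Y.
Proof.
move=> stX stY Yy.
by apply: rtrans_set_op; rewrite // card_set_op_steady ?card_steady.
Qed.

Lemma steady_injr X Y Z :
  steady X -> steady Y -> steady Z -> Y ** X = Z ** X -> Y = Z.
Proof.
move=> stX stY stZ; have [x Xx] := steady_n0 stX.
rewrite -(rtrans_steady stY stX Xx) -(rtrans_steady stZ stX Xx).
exact/imset_inj/injr.
Qed.

(** The translate [(X.y).z] fills the left side, by its size, and lies in the
    right side since [(x.y).z = (x.z).(y.z)]; both sides have the size of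
    [A]. *)
Lemma steady_distr X Y Z : steady X -> steady Y -> steady Z ->
  (X ** Y) ** Z = (X ** Z) ** (Y ** Z).
Proof.
move=> stX stY stZ; have [y Yy] := steady_n0 stY; have [z Zz] := steady_n0 stZ.
have stXY := steady_set_op stX stY.
have stXZ := steady_set_op stX stZ; have stYZ := steady_set_op stY stZ.
apply/eqP; rewrite eqEcard !card_set_op_steady // leqnn andbT.
rewrite -(rtrans_steady stXY stZ Zz) -(rtrans_steady stX stY Yy).
apply/subsetP=> _ /imsetP[_ /imsetP[x Xx ->] ->].
by rewrite distr !mem_set_op.
Qed.

(** All three products with [Z] are translations by one element [z], which is
    an automorphism. *)
Lemma steady_distl X Y Z : steady X -> steady Y -> steady Z ->
  Z ** (X ** Y) = (Z ** X) ** (Z ** Y).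
Proof.
move=> stX [[y ->] cY] stZ; have [z Zz] := steady_n0 stZ.
have [[x XE] _] := stX; have [w XYE] := steady_set_op_coset y stX.
rewrite XYE -(ltrans_steady w stZ Zz) -XYE -ltrans_set_op_distr.
by rewrite XE !(ltrans_steady _ stZ Zz).
Qed.

(** * The distributive groups [Gamma] and [Sigma] *)

Section Decomposition.

Variables (s : nat) (l : 'I_s.+1 -> T).
Hypothesis hl : coset_decomposition op A l.

Lemma coset_repr x : exists j, coset x = coset (l j).
Proof.
have [_ cover _] := hl; have [a Aa] := A_n0.
have : op a x \in \bigcup_(j < s.+1) coset (l j) by rewrite cover inE.
case/bigcupP=> j _ axj; exists j.
by apply: coset_eq axj; apply: mem_rtrans.
Qed.

Lemma mem_GammaP X : reflect (steady X) (X \in Gamma op A l).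
Proof.
apply: (iffP imsetP) => [[j] | [[x ->] cX]].
- rewrite inE => /forallP jP ->; split; first by exists (l j).
  move=> y; have [h ->] := coset_repr y.
  by apply/eqP; rewrite -set_op_coset_card.
- have [j jE] := coset_repr x; exists j => //.
  rewrite inE; apply/forallP=> h.
  by rewrite set_op_coset_card -jE cX.
Qed.

Lemma steady_self : steady A.
Proof.
have [a Aa] := A_n0; split; last exact: cardAA.
by exists a; rewrite rtrans_mem.
Qed.

Lemma Gamma_distributive_group :
  distributive_group (set_op op) (Gamma op A l).
Proof.
apply: distributive_group_fin.
- by exists A; apply/mem_GammaP/steady_self.
- by move=> X Y /mem_GammaP stX /mem_GammaP stY; apply/mem_GammaP/steady_set_op.
- move=> X /mem_GammaP stX Y Z /mem_GammaP stY /mem_GammaP stZ.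
  exact: steady_injl.
- move=> X /mem_GammaP stX Y Z /mem_GammaP stY /mem_GammaP stZ.
  exact: steady_injr.
- by move=> X Y Z /mem_GammaP stX /mem_GammaP stY /mem_GammaP stZ;
    apply: steady_distr.
- by move=> X Y Z /mem_GammaP stX /mem_GammaP stY /mem_GammaP stZ;
    apply: steady_distl.
Qed.

Lemma Sigma_subgroup : subgroup op (Sigma op A l).
Proof.
apply: distributive_group_fin.
- have [a Aa] := A_n0; exists a; rewrite inE; apply/existsP; exists A.
  by rewrite Aa andbT; apply/mem_GammaP/steady_self.
- move=> x y; rewrite !inE => /existsP[X /andP[/mem_GammaP stX Xx]].
  case/existsP=> Y /andP[/mem_GammaP stY Yy].
  apply/existsP; exists (X ** Y); rewrite mem_set_op // andbT.
  exact/mem_GammaP/steady_set_op.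
- by move=> a _ x y _ _; apply: injl.
- by move=> a _ x y _ _; apply: injr.
- by move=> a b c _ _ _; apply: distr.
- by move=> a b c _ _ _; apply: distl.
Qed.

End Decomposition.

End Cosets.

Theorem theorem5p11 (T : finType) (op : T -> T -> T) (A : {set T})
    (s : nat) (l : 'I_s.+1 -> T)
    (hG : distinguished op) (hA : simple_subgroup op A)
    (hl : coset_decomposition op A l) :
  distributive_group (set_op op) (Gamma op A l) /\ subgroup op (Sigma op A l).
Proof.
have [[_ _ soll solr [distr distl]] dist] := hG.
have [sgA _] := hA; have [A_n0 A_op _ _ _] := sgA.
have injl a : injective (op a).
  move=> x y E; have [z [_ uz]] := soll a (op a x) (in_setT _) (in_setT _).
  by rewrite -(uz x) ?(uz y).
have injr a : injective (op^~ a).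
  move=> x y E; have [z [_ uz]] := solr a (op x a) (in_setT _) (in_setT _).
  by rewrite -(uz x) ?(uz y).
have distrT a b c : op (op a b) c = op (op a c) (op b c) by apply: distr.
have distlT a b c : op c (op a b) = op (op c a) (op c b) by apply: distl.
have cardAA p : #|set_op op A (rtrans op A p)| = #|A|.
  by have [] := dist A p sgA.
by split; [apply: Gamma_distributive_group | apply: Sigma_subgroup].
Qed.
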